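(* Let $e\ge 2$ and $r\ge 2$ be integers. The simples in $\mathbf{B}^{\oplus}(e,e,r)$ are precisely the elements of the form $p_2p_3\cdots p_r$ where, for each $2\le k\le r$, $p_k$ is a left divisor of $\Lambda_k$.
   Context: $\mathbf{B}^{\oplus}(e,e,r)$ is the monoid defined by the monoid presentation with generators $T_e\cup S_r$, where $T_e=\{t_i\mid i\in\mathbb{Z}/e\}$ and $S_r=\{s_3,\dots,s_r\}$ (empty if $r=2$), and relations: (R1) $s_is_js_i=s_js_is_j$ for $|i-j|=1$; (R2) $s_is_j=s_js_i$ for $|i-j|>1$; (R3) $s_3t_is_3=t_is_3t_i$ for $i\in\mathbb{Z}/e$; (R4) $s_jt_i=t_is_j$ for $i\in\mathbb{Z}/e$ and $4\le j\le r$; (R5) $t_it_{i-1}=t_jt_{j-1}$ for $i,j\in\mathbb{Z}/e$. Relations involving $s_j$ occur only when $3\le j\le r$. Let $\tau=t_it_{i-1}$ (independent of $i$ by (R5)), $\Lambda_2=\tau$, and $\Lambda_p=s_p\cdots s_3\,\tau\, s_3\cdots s_p$ for $3\le p\le r$. An element $x$ left-divides $y$ if $y=xz$ for some $z$ in the monoid, and right-divides $y$ if $y=zx$ for some $z$. The monoid $\mathbf{B}^{\oplus}(e,e,r)$ is a Garside monoid with (minimal) Garside element $\Delta=\Lambda_2\Lambda_3\cdots\Lambda_r$, whose left and right divisors coincide; the simples are the divisors of $\Delta$. *)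

(* Defs.v *)
From HB Require Import structures.
From mathcomp Require Import all_boot all_algebra.
From mathcomp Require Import boolp.

Set Implicit Arguments.
Unset Strict Implicit.
Unset Printing Implicit Defensive.

Import GRing.Theory.
Local Open Scope group_scope.

(** The monoid presented by generators [A] and relations [R], as the quotient
    of the words over [A] by the congruence generated by [R]. *)

Inductive congr (A : Type) (R : seq A -> seq A -> Prop) :
    seq A -> seq A -> Prop :=
| congr_rel u v : R u v -> congr R u v
| congr_refl u : congr R u u
| congr_sym u v : congr R u v -> congr R v u
| congr_trans u v w : congr R u v -> congr R v w -> congr R u w
| congr_cat u u' v v' :
    congr R u u' -> congr R v v' -> congr R (u ++ v) (u' ++ v').

Section PresentedMonoid.
Variables (A : choiceType) (R : seq A -> seq A -> Prop).

Definition congrb : rel (seq A) := fun u v => `[< congr R u v >].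

Lemma congrb_refl : reflexive congrb.
Proof. by move=> u; apply/asboolP/congr_refl. Qed.

Lemma congrb_sym : symmetric congrb.
Proof. by move=> u v; apply/asboolP/asboolP => /congr_sym. Qed.

Lemma congrb_trans : transitive congrb.
Proof.
move=> v u w /asboolP uv /asboolP vw.
by apply/asboolP; apply: congr_trans uv vw.
Qed.

Definition congr_equiv := EquivRel congrb congrb_refl congrb_sym congrb_trans.

Definition presented : Type := {eq_quot congr_equiv}%qT.

HB.instance Definition _ := Choice.on presented.

Definition class_of (u : seq A) : presented := (\pi_({eq_quot congr_equiv}) u)%qT.
Definition word_of (x : presented) : seq A :=
  repr (x : {eq_quot congr_equiv}%qT).

Lemma word_ofK : cancel word_of class_of.
Proof. exact: reprK. Qed.

Lemma class_ofP u v : class_of u = class_of v <-> congr R u v.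
Proof.
by split=> [/eqmodP /asboolP //|uv]; apply/eqmodP/asboolP.
Qed.

Definition presented_one : presented := class_of [::].
Definition presented_mul (x y : presented) : presented :=
  class_of (word_of x ++ word_of y).

Lemma presented_mulE u v :
  presented_mul (class_of u) (class_of v) = class_of (u ++ v).
Proof. by apply/class_ofP/congr_cat; apply/class_ofP; rewrite word_ofK. Qed.

Lemma presented_mulA : associative presented_mul.
Proof.
move=> x y z; rewrite -(word_ofK x) -(word_ofK y) -(word_ofK z).
by rewrite !presented_mulE catA.
Qed.

Lemma presented_1mul : left_id presented_one presented_mul.
Proof. by move=> x; rewrite -(word_ofK x) presented_mulE. Qed.

Lemma presented_mul1 : right_id presented_one presented_mul.
Proof. by move=> x; rewrite -(word_ofK x) presented_mulE cats0. Qed.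

HB.instance Definition _ := isMonoid.Build presented
  presented_mulA presented_1mul presented_mul1.

Lemma class_of_cat u v : class_of (u ++ v) = class_of u * class_of v.
Proof. by rewrite [RHS]presented_mulE. Qed.

End PresentedMonoid.

(** The monoid B^(+)(e,e,r), for e >= 2: ['Z_e] is Z/e only when [1 < e]. *)

Definition gen (e r : nat) : Type := ('Z_e + {j : nat | 3 <= j <= r})%type.

HB.instance Definition _ e r := Choice.on (gen e r).

Section Braid.
Variables e r : nat.

Local Notation T i := (inl i : gen e r).
Local Notation S j := (inr j : gen e r).

Inductive braid_rel : seq (gen e r) -> seq (gen e r) -> Prop :=
| braid_R1 i j : val i = (val j).+1 \/ val j = (val i).+1 ->
    braid_rel [:: S i; S j; S i] [:: S j; S i; S j]
| braid_R2 i j : (val i).+1 < val j \/ (val j).+1 < val i ->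
    braid_rel [:: S i; S j] [:: S j; S i]
| braid_R3 j i : val j = 3 ->
    braid_rel [:: S j; T i; S j] [:: T i; S j; T i]
| braid_R4 j i : 4 <= val j ->
    braid_rel [:: S j; T i] [:: T i; S j]
| braid_R5 i j :
    braid_rel [:: T i; T (i - 1)%R] [:: T j; T (j - 1)%R].

Definition braid : Type := presented braid_rel.

HB.instance Definition _ := Monoid.on braid.

Definition t (i : 'Z_e) : braid := class_of braid_rel [:: T i].

(* The value outside 3 <= j <= r is irrelevant. *)
Definition s (j : nat) : braid :=
  if insub j is Some j' then class_of braid_rel [:: S j'] else 1.

(* By R5, tau = t_i t_(i-1) for every i; here i = 1. *)
Definition tau : braid := t 1%R * t 0%R.

(* Lambda p = s_p ... s_3 tau s_3 ... s_p, so that Lambda 2 = tau; only used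
   for 2 <= p <= r. *)
Definition Lambda (p : nat) : braid :=
  (\prod_(j <- rev (index_iota 3 p.+1)) s j) * tau
    * \prod_(3 <= j < p.+1) s j.

Definition Delta : braid := \prod_(2 <= p < r.+1) Lambda p.

End Braid.

Definition ldvd (M : monoidType) (x y : M) : Prop := exists z, y = x * z.

(* Left and right divisors of Delta coincide, so "divisor" is taken to be
   "left divisor". *)
Definition simple (e r : nat) (x : braid e r) : Prop := ldvd x (Delta e r).

(* Main.v *)
Require Import Defs.
From mathcomp Require Import all_boot all_algebra.
From mathcomp Require Import zify.

(** The prefixes of the words s_k ... s_3 t_i t_(i-1) s_3 ... s_k give
    finitely many left divisors of Lambda_k.  The generators act partially on
    the right on tuples (p_2, ..., p_r) of such prefixes: a generator g either
    extends p_r, or satisfies p_r g = g' p_r with g' a generator of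
    B(e,e,r-1), which is then passed on to p_(r-1), or is undefined.  This
    partial action respects the defining relations, so the monoid itself acts;
    acting on (1, ..., 1) with Delta is defined, hence so is acting with any
    left divisor x of Delta, and the resulting tuple is a factorization of x.

    Conversely, Lambda_r is quasi-central over B(e,e,r-1): if
    p_2 ... p_(r-1) z = Lambda_2 ... Lambda_(r-1), z Lambda_r = Lambda_r y and
    p_r q = Lambda_r, then p_2 ... p_r (q y) = Lambda_2 ... Lambda_r. *)

Set Implicit Arguments.
Unset Strict Implicit.
Unset Printing Implicit Defensive.

Import GRing.Theory.
Local Open Scope group_scope.

Ltac decide_ifs := repeat match goal with
  | |- context [if ?b then _ else _] =>
    first [ have -> : b = true by lia | have -> : b = false by lia ] end.

Ltac run := repeat (progress (rewrite /= ?eqxx; decide_ifs)).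

(** * The partial action on tuples of prefixes *)

Section PartialAction.
Variable e : nat.

(* [LS a] stands for s_(a+3).  At level k, [Down b] stands for
   s_k ... s_(b+3), [Mid i] for s_k ... s_3 t_i and [Up c] for
   s_k ... s_3 tau s_3 ... s_(c+2).  With these shifts the rules do not mention
   k, and the relations hold for all tuples, even meaningless ones. *)
Inductive letter := LT of 'Z_e | LS of nat.
Inductive state := Down of nat | Mid of 'Z_e | Up of nat.

(* [inl] extends the state, [inr] passes a letter to the level below. *)
Definition step (p : state) (g : letter) : option (state + letter) :=
  match p, g with
  | Down b, LT i => Some (if b == 0 then inl (Mid i) else inr (LT i))
  | Down b, LS a =>
      if a == b then None
      else Some (if a.+1 == b then inl (Down a)
                 else inr (LS (if a < b then a else a.-1)))
  | Mid i, LT j => if j == (i - 1)%R then Some (inl (Up 0)) else None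
  | Mid i, LS a => Some (inr (if a is a'.+1 then LS a' else LT i))
  | Up c, LT i => if c == 0 then None else Some (inr (LT (i + 1)%R))
  | Up c, LS a =>
      if a.+1 == c then None
      else Some (if a == c then inl (Up c.+1)
                 else inr (LS (if a < c then a else a.-1)))
  end.

(* The list [:: p_r; ...; p_2] has the highest level first. *)
Fixpoint act (g : letter) (L : seq state) : option (seq state) :=
  if L is p :: L' then
    match step p g with
    | None => None
    | Some (inl p') => Some (p' :: L')
    | Some (inr g') => omap (cons p) (act g' L')
    end
  else None.

Fixpoint acts (w : seq letter) (L : seq state) : option (seq state) :=
  if w is g :: w' then obind (acts w') (act g L) else Some L.

Lemma acts_cons g w L : acts (g :: w) L = obind (acts w) (act g L).
Proof. by []. Qed.

Lemma acts_cat u v L : acts (u ++ v) L = obind (acts v) (acts u L).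
Proof. by elim: u L => //= g u IH L; case: (act g L). Qed.

Lemma act_pass p g g' L :
  step p g = Some (inr g') -> act g (p :: L) = omap (cons p) (act g' L).
Proof. by move=> /= ->. Qed.

(** This drives the inductions below: where the top entry only passes letters on, a relation between
    words at one level reduces to a relation between the passed words one level below. *)
Lemma acts_passes p w w' L :
  [seq step p g | g <- w] = [seq Some (inr g) | g <- w'] ->
  acts w (p :: L) = omap (cons p) (acts w' L).
Proof.
elim: w w' L => [|g w IH] [|g' w'] L //= [stepE /IH{}IH].
by rewrite stepE; case: (act g' L) => //= L'; rewrite IH.
Qed.

(** * Invariance of the partial action under R1 to R5 *)

Implicit Type L : seq state.

Lemma acts_R5 i j L : acts [:: LT i; LT (i - 1)%R] L =
  acts [:: LT j; LT (j - 1)%R] L.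
Proof.
have shift (k : 'Z_e) : (k - 1 + 1 = k + 1 - 1)%R by rewrite addrAC.
elim: L i j => // -[[|b]|a|[|c]] L IH i j.
- by rewrite /= !eqxx.
- rewrite (@acts_passes _ _ [:: LT i; LT (i - 1)%R]) //.
  by rewrite (@acts_passes _ _ [:: LT j; LT (j - 1)%R]) // (IH i j).
- by rewrite /=; do 2![case: ifP => //= _].
- by [].
(* [Up c.+1] passes each [t_k] down as [t_(k+1)], which sends R5 to another instance of R5. *)
- rewrite (@acts_passes _ _ [:: LT (i + 1)%R; LT (i + 1 - 1)%R]);
  last by rewrite /= shift.
  rewrite (@acts_passes _ _ [:: LT (j + 1)%R; LT (j + 1 - 1)%R]);
    last by rewrite /= shift.
  by rewrite (IH (i + 1)%R (j + 1)%R).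
Qed.

Lemma acts_R3 i L : acts [:: LS 0; LT i; LS 0] L = acts [:: LT i; LS 0; LT i] L.
Proof.
elim: L i => // -[[|[|b]]|a|[|[|c]]] L IH i.
- rewrite /=; case: (act _ L) => //= L1.
  (* The left side is undefined. So is the right side: after [Mid i] only [t_(i-1)] may follow, and
     [i] differs from [i - 1] because 1 is nonzero in ['Z_e]. *)
  by rewrite eq_sym -subr_eq0 addrAC subrr add0r oppr_eq0 oner_eq0.
- by rewrite /=; case: (act _ L) => //= *; run.
- rewrite (@acts_passes _ [:: LS 0; LT i; LS 0] [:: LS 0; LT i; LS 0]) //.
  by rewrite (@acts_passes _ [:: LT i; LS 0; LT i] [:: LT i; LS 0; LT i]) // IH.
- have [->|/negPf ia] := eqVneq i (a - 1)%R; rewrite /= ?eqxx ?ia /= ?subrK;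
    by case: (act _ L) => //= L1; rewrite ?eqxx ?ia.
- by rewrite /=; case: (act _ L) => //= *; run.
- by rewrite /=; case: (act _ L) => //= *; run.
- rewrite (@acts_passes _ _ [:: LS 0; LT (i + 1)%R; LS 0]) //.
  by rewrite (@acts_passes _ _ [:: LT (i + 1)%R; LS 0; LT (i + 1)%R]) // IH.
Qed.

Lemma acts_R4 a i L : acts [:: LS a.+1; LT i] L = acts [:: LT i; LS a.+1] L.
Proof.
elim: L a i => // -[[|b]|j|[|c]] L IH a i.
- by rewrite /=; case: (act _ L) => //= *; run.
- have [ab|ab|->] := ltngtP a b.
  + have [<-|ab'] := eqVneq a.+1 b; first by run; case: (act _ L) => //= *; run.
    rewrite (@acts_passes _ [:: LS a.+1; LT i] [:: LS a.+1; LT i]); last by run.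
    by rewrite (@acts_passes _ [:: LT i; LS a.+1] [:: LT i; LS a.+1]) ?IH; run.
  + case: a ab => // a ab.
    rewrite (@acts_passes _ [:: LS a.+2; LT i] [:: LS a.+1; LT i]); last by run.
    by rewrite (@acts_passes _ [:: LT i; LS a.+2] [:: LT i; LS a.+1]) ?IH; run.
  + by run; case: (act _ L) => //= *; run.
- have [->|/negPf ij] := eqVneq i (j - 1)%R; rewrite /= ?eqxx ?ij /=;
    by case: (act _ L) => //= L1; rewrite ?eqxx ?ij.
- by rewrite /=; case: (act _ L) => //= *; run.
- have [ac|ac|->] := ltngtP a.+1 c.+1;
  last by run; case: (act _ L) => //= *; run.
  + have [<-|ac'] := eqVneq a.+1 c; first by run; case: (act _ L) => //= *; run.
    rewrite (@acts_passes _ [:: LS a.+1; LT i] [:: LS a.+1; LT (i + 1)%R]); last by run.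
    by rewrite (@acts_passes _ [:: LT i; LS a.+1] [:: LT (i + 1)%R; LS a.+1]) ?IH; run.
  + case: a ac => // a ac.
    rewrite (@acts_passes _ [:: LS a.+2; LT i] [:: LS a.+1; LT (i + 1)%R]); last by run.
    by rewrite (@acts_passes _ [:: LT i; LS a.+2] [:: LT (i + 1)%R; LS a.+1]) ?IH; run.
Qed.

Lemma acts_R2 a b L : a.+1 < b ->
  acts [:: LS a; LS b] L = acts [:: LS b; LS a] L.
Proof.
elim: L a b => // -[d|j|c] L IH a b ab.
- have [|ad] := boolP ((a == d) || (b == d)).
    by case/orP=> /eqP <-; run; case: (act _ L) => //=; run.
  have [ad'|ad'] := eqVneq a.+1 d.
    by subst d; run; case: (act _ L) => //= *; run.
  have [bd'|bd'] := eqVneq b.+1 d.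
    by subst d; run; case: (act _ L) => //= *; run.
  (* [f] is the index change undergone by a passed letter. As [a] and [b] avoid [d] and [d - 1], it
     keeps them at least 2 apart, so R2 persists below. *)
  pose f x : letter := LS (if x < d then x else x.-1).
  rewrite (@acts_passes _ _ [:: f a; f b]); last by rewrite /f; run.
  rewrite (@acts_passes _ _ [:: f b; f a]); last by rewrite /f; run.
  by rewrite IH //; case: (ltnP a d) => ?; case: (ltnP b d) => ?; lia.
- case: b ab => // b ab; case: a ab => [|a] ab.
    (* [Mid j] turns [s_3] into [t_j], so this instance of R2 becomes R4 one level below. *)
    rewrite (@acts_passes _ _ [:: LT j; LS b]) //.
    rewrite (@acts_passes _ _ [:: LS b; LT j]) //.
    by case: b ab => // b _; rewrite acts_R4.
  rewrite (@acts_passes _ _ [:: LS a; LS b]) //.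
  by rewrite (@acts_passes _ _ [:: LS b; LS a]) // IH.
- have [|ac] := boolP ((a.+1 == c) || (b.+1 == c)).
    by case/orP=> /eqP <-; run; case: (act _ L) => //=; run.
  have [ac'|ac'] := eqVneq a c.
    by subst c; run; case: (act _ L) => //= *; run.
  have [bc'|bc'] := eqVneq b c.
    by subst c; run; case: (act _ L) => //= *; run.
  pose f x : letter := LS (if x < c then x else x.-1).
  rewrite (@acts_passes _ _ [:: f a; f b]); last by rewrite /f; run.
  rewrite (@acts_passes _ _ [:: f b; f a]); last by rewrite /f; run.
  by rewrite IH //; case: (ltnP a c) => ?; case: (ltnP b c) => ?; lia.
Qed.

Lemma acts_R1 a L : acts [:: LS a; LS a.+1; LS a] L =
  acts [:: LS a.+1; LS a; LS a.+1] L.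
Proof.
elim: L a => // -[d|j|c] L IH a.
- have [<-|ne0] := eqVneq a.+2 d; first by run; case: (act _ L) => //=; run.
  have [<-|ne1] := eqVneq a.+1 d; first by run; case: (act _ L) => //=; run.
  have [<-|ne2] := eqVneq a d; first by run; case: (act _ L) => //=; run.
  have [ad|ad] := ltnP a d.
    rewrite (@acts_passes _ _ [:: LS a; LS a.+1; LS a]); last by run.
    by rewrite (@acts_passes _ _ [:: LS a.+1; LS a; LS a.+1]) ?IH; run.
  case: a ne0 ne1 ne2 ad => [|a] ne0 ne1 ne2 ad; first lia.
  rewrite (@acts_passes _ _ [:: LS a; LS a.+1; LS a]); last by run.
  by rewrite (@acts_passes _ _ [:: LS a.+1; LS a; LS a.+1]) ?IH; run.
- case: a => [|a].
    (* For the same reason the braid relation between [s_3] and [s_4] becomes R3 below. *)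
    rewrite (@acts_passes _ _ [:: LT j; LS 0; LT j]) //.
    by rewrite (@acts_passes _ _ [:: LS 0; LT j; LS 0]) // acts_R3.
  rewrite (@acts_passes _ _ [:: LS a; LS a.+1; LS a]) //.
  by rewrite (@acts_passes _ _ [:: LS a.+1; LS a; LS a.+1]) // IH.
- have [<-|ne0] := eqVneq a.+2 c; first by run; case: (act _ L) => //=; run.
  have [<-|ne1] := eqVneq a.+1 c; first by run; case: (act _ L) => //=; run.
  have [<-|ne2] := eqVneq a c; first by run; case: (act _ L) => //=; run.
  have [ac|ac] := ltnP a c.
    rewrite (@acts_passes _ _ [:: LS a; LS a.+1; LS a]); last by run.
    by rewrite (@acts_passes _ _ [:: LS a.+1; LS a; LS a.+1]) ?IH; run.
  case: a ne0 ne1 ne2 ac => [|a] ne0 ne1 ne2 ac; first lia.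
  rewrite (@acts_passes _ _ [:: LS a; LS a.+1; LS a]); last by run.
  by rewrite (@acts_passes _ _ [:: LS a.+1; LS a; LS a.+1]) ?IH; run.
Qed.

End PartialAction.

Arguments acts : simpl never.

(** * Compatibility of the action with the congruence *)

Section Braid.
Variables e r : nat.

Definition letter_of (g : gen e r) : letter e :=
  match g with inl i => LT i | inr j => LS e (val j - 3) end.

Lemma acts_congr u v L : congr (@braid_rel e r) u v ->
  acts (map letter_of u) L = acts (map letter_of v) L.
Proof.
move=> uv; elim: uv L =>
  {u v} [u v uvR|u|u v _ IH|u v w _ IH1 _ IH2|u u' v v' _ IH1 _ IH2] L //.
- case: uvR => [[a ha] [b hb] ab|[a ha] [b hb] ab|j i j3|j i j4|i j]; rewrite /letter_of /=.
  + have [b3 a3] : 3 <= b /\ 3 <= a by lia.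
    by case: ab => /= ->; rewrite subSn // acts_R1.
  + have [b3 a3] : 3 <= b /\ 3 <= a by lia.
    by case: ab => /= ab; [|symmetry]; apply: acts_R2; lia.
  + by rewrite j3 acts_R3.
  + by rewrite -(subnSK j4) acts_R4.
  + exact: acts_R5.
- by rewrite IH1.
- by rewrite !map_cat !acts_cat IH1; case: (acts _ L) => //= L'.
Qed.

Local Notation B := (braid e r).
Local Notation s := (s e r).
Local Notation t := (@t e r).
Local Notation tau := (tau e r).
Local Notation Lambda := (Lambda e r).
Local Notation cl := (class_of (@braid_rel e r) : seq (gen e r) -> B).

(** * The defining relations as identities in the monoid *)

Lemma clM u v : cl (u ++ v) = cl u * cl v.
Proof. exact: class_of_cat. Qed.

Lemma cl_nil : cl [::] = 1.
Proof. by []. Qed.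

Lemma cl_rel u v : braid_rel u v -> cl u = cl v.
Proof. by move=> uv; apply/class_ofP/congr_rel. Qed.

Lemma s_in j (jr : 3 <= j <= r) : s j = cl [:: inr (exist _ j jr)].
Proof. exact: (congr1 (oapp _ 1) (valK (exist _ j jr :
  {j | 3 <= j <= r}))). Qed.

(** The default value commutes with everything, which settles the out-of-range cases of the
    commutation lemmas. *)
Lemma s_out j : ~~ (3 <= j <= r) -> s j = 1.
Proof. by move=> j_out; rewrite /Defs.s insubN. Qed.

Lemma s_braid i : 2 < i < r -> s i * s i.+1 * s i = s i.+1 * s i * s i.+1.
Proof.
move=> ir; have hi : 3 <= i <= r by lia. have hi1 : 3 <= i.+1 <= r by lia.
by rewrite (s_in hi) (s_in hi1) -!clM; apply/cl_rel/braid_R1; right.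
Qed.

Lemma s_comm i j : i.+1 < j -> s i * s j = s j * s i.
Proof.
move=> ij; have [hi|/s_out->] := boolP (3 <= i <= r);
  last by rewrite mul1g mulg1.
have [hj|/s_out->] := boolP (3 <= j <= r); last by rewrite mul1g mulg1.
by rewrite (s_in hi) (s_in hj) -!clM; apply/cl_rel/braid_R2; left.
Qed.

Lemma s3_t i : 3 <= r -> s 3 * t i * s 3 = t i * s 3 * t i.
Proof.
move=> r3; have h3 : 3 <= 3 <= r by [].
by rewrite (s_in h3) /Defs.t -!clM; apply/cl_rel/braid_R3.
Qed.

Lemma s_t j i : 3 < j -> s j * t i = t i * s j.
Proof.
move=> j4; have [hj|/s_out->] := boolP (3 <= j <= r);
  last by rewrite mul1g mulg1.
by rewrite (s_in hj) /Defs.t -!clM; apply/cl_rel/braid_R4.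
Qed.

Lemma t_tau i : t i * t (i - 1)%R = tau.
Proof.
by rewrite /Defs.tau -[in t 0%R](subrr 1%R) /Defs.t -!clM; apply/cl_rel/braid_R5.
Qed.

Lemma s_tau j : 3 < j -> s j * tau = tau * s j.
Proof. by move=> j4; rewrite mulgA s_t // -mulgA s_t // mulgA. Qed.

(** * Moving generators across the factors of [Lambda k] *)

Definition down k j : B := \prod_(x <- rev (index_iota j k.+1)) s x.
Definition up k : B := \prod_(3 <= x < k.+1) s x.

Lemma down_nil k j : k < j -> down k j = 1.
Proof. by move=> kj; rewrite /down /index_iota (eqP (_ :
  k.+1 - j == 0)) ?big_nil //; lia. Qed.

Lemma down_l k j : j <= k.+1 -> down k.+1 j = s k.+1 * down k j.
Proof.
by move=> jk; rewrite /down /index_iota subSn // -addn1 iotaD rev_cat /= big_cons subnKC.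
Qed.

Lemma down_r k j : j <= k -> down k j = down k j.+1 * s j.
Proof.
by move=> jk; rewrite /down /index_iota subSS subSn //= rev_cons big_rcons.
Qed.

Lemma up_r k : 2 <= k -> up k.+1 = up k * s k.+1.
Proof. by move=> k2; rewrite /up big_nat_recr. Qed.

Lemma up_nil k : k <= 2 -> up k = 1.
Proof. by move=> k2; rewrite /up big_geq. Qed.

Lemma down_s_lt k j m : m.+1 < j -> down k j * s m = s m * down k j.
Proof.
move=> mj; elim: k => [|k IH]; first by rewrite down_nil ?mul1g ?mulg1 //; lia.
have [jk|kj] := leqP j k.+1; last by rewrite down_nil ?mul1g ?mulg1.
by rewrite down_l // -mulgA IH !mulgA (@s_comm m) //; lia.
Qed.

Lemma down_t k j i : 3 < j -> down k j * t i = t i * down k j.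
Proof.
move=> j4; elim: k => [|k IH]; first by rewrite down_nil ?mul1g ?mulg1 //; lia.
have [jk|kj] := leqP j k.+1; last by rewrite down_nil ?mul1g ?mulg1.
by rewrite down_l // -mulgA IH !mulgA s_t //; lia.
Qed.

Lemma down_s_far k j m : 0 < j -> k.+1 < m -> down k j * s m = s m * down k j.
Proof.
move=> j0; elim: k => [|k IH] km; first by rewrite down_nil ?mul1g ?mulg1.
have [jk|kj] := leqP j k.+1; last by rewrite down_nil ?mul1g ?mulg1.
by rewrite down_l // -mulgA IH ?mulgA -?(@s_comm _ m) //; lia.
Qed.

(** Moving left, [s m.+1] commutes with the factors below [s m]; the braid relation turns it into
    [s m], which commutes with the factors above [s m.+1]. *)
Lemma down_s_gt k j m : 2 < j <= m -> m < k <= r ->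
  down k j * s m.+1 = s m * down k j.
Proof.
move=> jm; elim: k => [|k IH] mk; first lia.
have [mk'|mk'] := ltnP m k.
  rewrite down_l; last lia.
  by rewrite -mulgA IH ?mulgA ?(@s_comm m k.+1) //; lia.
have ->: k = m by lia.
rewrite down_l; last lia.
case: m jm {IH mk'} mk => [|m] jm mk; first lia.
rewrite down_l; last lia.
rewrite -!mulgA down_s_far; try lia.
by rewrite !mulgA s_braid //; lia.
Qed.

Lemma up_s_gt k m : k.+1 < m -> up k * s m = s m * up k.
Proof.
elim: k => [|k IH] km; first by rewrite up_nil ?mul1g ?mulg1.
have [k2|k2] := leqP 2 k; last by rewrite up_nil ?mul1g ?mulg1 //; lia.
by rewrite up_r // -mulgA s_comm ?mulgA ?IH //; lia.
Qed.

Lemma up_s_lt k m : 2 < m < k -> k <= r -> up k * s m = s m.+1 * up k.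
Proof.
elim: k => [|k IH] mk kr; first lia.
have [mk'|mk'] := ltnP m k.
  rewrite up_r; last lia.
  by rewrite -mulgA -(@s_comm m k.+1) ?mulgA ?IH //; lia.
have {IH mk'} ->: k = m by lia.
case: m mk kr => [|m] mk kr; first lia.
rewrite !up_r; try lia.
rewrite -!mulgA !(mulgA (s _)) s_braid; last lia.
by rewrite !mulgA up_s_gt //; lia.
Qed.

(** This lowers the index that [up_s_lt] raises; together they make [Lambda k] commute with [s m]
    for [2 < m < k]. *)
Lemma down_tau_s k m : 2 < m < k -> k <= r ->
  down k 3 * tau * s m.+1 = s m * (down k 3 * tau).
Proof.
move=> mk kr; rewrite -mulgA -s_tau; last lia.
by rewrite mulgA down_s_gt ?mulgA //; lia.
Qed.

(** Writing [tau] as [t_(i+1) t_i], two uses of R3 give [s_3 tau s_3 t_i = t_(i+1) s_3 tau s_3]; all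
    other factors [s_j] have [j > 3] and commute with the [t]'s. *)
Lemma down_tau_up_t k c i : 2 < c <= k -> k <= r ->
  down k 3 * tau * up c * t i = t (i + 1)%R * (down k 3 * tau * up c).
Proof.
have : tau = t (i + 1)%R * t i by rewrite -(t_tau (i + 1)%R) addrK.
move: tau => T TE; elim: c => [|c IH] ck kr; first lia.
have [c3|c3] := leqP 3 c.
  rewrite up_r ?mulgA; last lia.
  rewrite -(mulgA _ (s c.+1)) s_t; last lia.
  by rewrite !mulgA IH ?mulgA //; lia.
have {IH c3} -> : c.+1 = 3 by lia.
rewrite up_r // up_nil // mul1g down_r; last lia.
rewrite TE !mulgA -(mulgA _ (s 3) (t i)) -(mulgA _ (t i)).
rewrite [t i * (s 3 * t i)]mulgA -s3_t; last lia.
rewrite !mulgA -(mulgA (down k 4)) -(mulgA (down k 4)) s3_t; last lia.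
by rewrite !mulgA down_t.
Qed.

(** * Soundness of the action: tuples evaluated in the monoid *)

Definition level (k : nat) (g : letter e) : bool :=
  if g is LS a then a.+2 < k else 1 < k.

(** The bound for [Down b] admits [b = k - 2], the empty prefix; the bound for [Up c] admits
    [c = k - 2], all of [Lambda k]. *)
Definition valid (k : nat) (p : state e) : bool :=
  match p with Down b => b.+1 < k | Mid _ => true | Up c => c.+1 < k end.

Definition letter_val (g : letter e) : B :=
  match g with LT i => t i | LS a => s a.+3 end.

Definition state_val (k : nat) (p : state e) : B :=
  match p with
  | Down b => down k b.+3
  | Mid i => down k 3 * t i
  | Up c => down k 3 * tau * up c.+2
  end.

Lemma step_val k p g : k <= r -> valid k p -> level k g ->
  match step p g with
  | None => True
  | Some (inl p') => valid k p' /\ state_val k p' = state_val k p * letter_val g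
  | Some (inr g') => level k.-1 g' /\
      state_val k p * letter_val g = letter_val g' * state_val k p
  end.
Proof.
move=> kr; case: p g => [b|i|c] [j|a] /=.
- case: eqP => [-> //|b0] bk k2; split=> /=; first lia.
  by rewrite down_t //; lia.
- move=> bk ak; case: eqP => // /eqP ab; case: eqP => [<-|ab'].
    by split=> /=; [lia|rewrite -down_r //; lia].
  case: ltnP => ab''; first by split=> /=; [lia|rewrite down_s_lt //; lia].
  case: a ab ab' ab'' ak => [|a] *; first lia.
  by split=> /=; [lia|rewrite down_s_gt //; lia].
- by case: eqP => // -> _ k2; split=> //=; rewrite up_nil // mulg1 -(t_tau i) mulgA.
- case: a => [|a] _ ak /=; split; try lia.
    (* By R3 the final [s_3 t_i s_3] is [t_i s_3 t_i], and its first [t_i] leaves to the left. *)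
    rewrite down_r -?(mulgA (down k 4)); last lia.
    by rewrite s3_t ?mulgA ?down_t //; lia.
  by rewrite -mulgA -s_t // mulgA down_s_gt ?mulgA //; lia.
- by case: eqP => // /eqP c0 ck k2; split=> /=; [|apply: down_tau_up_t]; lia.
- move=> ck ak; case: eqP => // /eqP ac; case: eqP => [ac'|ac'].
    by split=> /=; [lia|rewrite ac' up_r // mulgA].
  case: ltnP => ac''.
    split=> /=; first lia.
    rewrite -mulgA up_s_lt; try lia.
    by rewrite mulgA down_tau_s -?mulgA //; lia.
  case: a ac ac' ac'' ak => [|a] *; first lia.
  split=> /=; first lia.
  rewrite -mulgA up_s_gt; last lia.
  by rewrite mulgA down_tau_s -?mulgA //; lia.
Qed.

(** Levels start at 2, so an entry followed by n others sits at level n + 2. *)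
Fixpoint valid_seq (L : seq (state e)) : bool :=
  if L is p :: L' then valid (size L').+2 p && valid_seq L' else true.

Fixpoint seq_val (L : seq (state e)) : B :=
  if L is p :: L' then seq_val L' * state_val (size L').+2 p else 1.

Lemma act_val g L L' :
  size L < r -> valid_seq L -> level (size L).+1 g -> act g L = Some L' ->
  [/\ size L' = size L, valid_seq L' & seq_val L' = seq_val L * letter_val g].
Proof.
elim: L g L' => //= p L IH g L' Lr /andP[pV LV] gV.
have := step_val Lr pV gV.
case: (step p g) => [[p'|g']|//] [V E].
  by case=> <-; rewrite /= V LV E mulgA.
case actE: (act g' L) => [L1|//] [<-] /=.
have [-> -> ->] := IH g' L1 (ltnW Lr) LV V actE.
by rewrite pV -!mulgA E.
Qed.

Lemma letter_of_val g : letter_val (letter_of g) = cl [:: g].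
Proof.
case: g => [//|[j jr]] /=; have /subnK : 3 <= j by lia.
by rewrite addn3 => ->; rewrite s_in.
Qed.

Lemma letter_of_level g : 1 < r -> level r (letter_of g).
Proof. by case: g => [//|[j jr]] /= _; lia. Qed.

Lemma acts_val u L L' : 1 < r -> (size L).+1 = r -> valid_seq L ->
  acts (map letter_of u) L = Some L' ->
  [/\ size L' = size L, valid_seq L' & seq_val L' = seq_val L * cl u].
Proof.
move=> r2; elim: u L => [|g u IH] L Lr LV.
  by rewrite /acts => -[<-]; split=> //; rewrite cl_nil mulg1.
rewrite map_cons acts_cons.
case actE: (act _ L) => [L1|//] /= uE.
have gr : level (size L).+1 (letter_of g) by rewrite Lr letter_of_level.
have Lr' : size L < r by rewrite Lr.
have [sz1 V1 E1] := act_val Lr' LV gr actE.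
have [|sz2 V2 E2] := IH L1 _ V1 uE; first by rewrite sz1.
by split=> //; [rewrite sz2|rewrite E2 E1 letter_of_val -mulgA -clM].
Qed.

(** * The partial action of monoid elements *)

Definition actm (x : B) (L : seq (state e)) : option (seq (state e)) :=
  acts (map letter_of (word_of x)) L.

Lemma actm_cl u L : actm (cl u) L = acts (map letter_of u) L.
Proof. by apply/acts_congr/class_ofP; rewrite word_ofK. Qed.

Lemma actmM x y L : actm (x * y) L = obind (actm y) (actm x L).
Proof.
rewrite -[x]word_ofK -[y]word_ofK -clM actm_cl map_cat acts_cat -actm_cl.
by case: (actm _ L) => //= L'; rewrite actm_cl.
Qed.

Lemma actm1 L : actm 1 L = Some L.
Proof. exact: actm_cl. Qed.

Lemma actm_t i L : actm (t i) L = act (LT i) L.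
Proof. by rewrite actm_cl /acts /=; case: (act _ L). Qed.

Lemma actm_s a L : a.+3 <= r -> actm (s a.+3) L = act (LS e a) L.
Proof.
move=> ar; have ar' : 3 <= a.+3 <= r by [].
by rewrite (s_in ar') actm_cl /acts /= !subSS subn0; case: (act _ L).
Qed.

(** * Elements of lower level and quasi-centrality of [Lambda k] *)

Definition gen_le (k : nat) (g : gen e r) : bool :=
  if g is inr j then val j <= k else 1 < k.

Definition within (k : nat) (x : B) : bool := all (gen_le k) (word_of x).

(** The two sides of each relation involve generators of the same levels, so [within] does not
    depend on the representative word. *)
Lemma gen_le_congr k u v :
  congr (@braid_rel e r) u v -> all (gen_le k) u = all (gen_le k) v.
Proof.
elim=> {u v} [u v uv|//|u v _ -> //|u v w _ -> _ -> //|u u' v v' _ uu' _ vv'].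
  by case: uv => * /=; lia.
by rewrite !all_cat uu' vv'.
Qed.

Lemma within_cl k u : within k (cl u) = all (gen_le k) u.
Proof. by apply/gen_le_congr/class_ofP; rewrite word_ofK. Qed.

Lemma withinM k x y : within k (x * y) = within k x && within k y.
Proof. by rewrite -[x * y]/(cl (_ ++ _)) within_cl all_cat. Qed.

Lemma within1 k : within k 1.
Proof. by rewrite within_cl. Qed.

Lemma within_t k i : 1 < k -> within k (t i).
Proof. by move=> k2; rewrite within_cl /= k2. Qed.

Lemma within_s k j : j <= k -> within k (s j).
Proof.
move=> jk; have [jr|/s_out->] := boolP (3 <= j <= r); last exact: within1.
by rewrite (s_in jr) within_cl /= jk.
Qed.

Lemma withinW k l x : k <= l -> within k x -> within l x.
Proof. by move=> kl; apply: sub_all => -[i|j] /=; lia. Qed.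

Lemma LambdaE k : Lambda k = down k 3 * tau * up k.
Proof. by []. Qed.

Lemma within_Lambda k : 1 < k -> within k (Lambda k).
Proof.
move=> k2; rewrite LambdaE !withinM !within_t //.
rewrite [X in X && _](_ : _ = true) /= ?andbT.
  rewrite /up big_nat_cond; elim/big_rec: _ =>
    [|j x jk xk]; first exact: within1.
  by rewrite withinM xk within_s //; lia.
rewrite /down big_seq; elim/big_rec: _ => [|j x]; first exact: within1.
by rewrite mem_rev mem_index_iota withinM => jk ->; rewrite within_s //; lia.
Qed.

(** Letter by letter: [t_i] crosses [Lambda k] as [t_(i-1)], and [s_j] with [j < k] crosses
    unchanged. *)
Lemma Lambda_quasicentral k x : k <= r -> within k.-1 x ->
  exists2 y, within k y & x * Lambda k = Lambda k * y.
Proof.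
move=> kr; rewrite {1}/within -{2}[x]word_ofK; elim: (word_of x) =>
  {x} [|g u IH] /=.
  by exists 1; rewrite ?within1 // cl_nil mul1g mulg1.
case/andP=> gk /IH[y yk uE].
have [z zk gE] : exists2 z, within k z & cl [:: g] * Lambda k = Lambda k * z.
  case: g gk => [i|[j jr]] /= gk.
    exists (t (i - 1)%R); first by apply: within_t; lia.
    by rewrite LambdaE down_tau_up_t ?subrK //; lia.
  exists (s j); first by apply: within_s; lia.
  rewrite -s_in LambdaE -(mulgA _ _ (s j)) up_s_lt; try lia.
  by rewrite mulgA -down_tau_s -?mulgA //; lia.
exists (z * y); first by rewrite withinM zk.
by rewrite -cat1s clM -mulgA uE mulgA gE mulgA.
Qed.

(** The level bound on the cofactor is carried along because quasi-centrality of the next [Lambda]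
    concerns elements of the level below it. *)
Lemma ldvd_prod_Lambda n (p : nat -> B) : n < r ->
  (forall k, 2 <= k <= n.+1 -> ldvd (p k) (Lambda k)) ->
  exists2 z, within n.+1 z &
    \prod_(2 <= k < n.+2) Lambda k = (\prod_(2 <= k < n.+2) p k) * z.
Proof.
elim: n => [|n IH] nr pL;
  first by exists 1; rewrite ?within1 // !big_geq ?mulg1.
have [||z zn zE] := IH; [lia|by move=> k kn; apply: pL; lia|].
have [q qE] : ldvd (p n.+2) (Lambda n.+2) by apply: pL; lia.
have qn : within n.+2 q.
  (* [withinM] is an equality, so the bound passes from a product to its factors. *)
  by have := @within_Lambda n.+2 isT; rewrite qE withinM => /andP[].
have [y yn yE] := Lambda_quasicentral nr zn.
exists (q * y); first by rewrite withinM qn.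
by rewrite !(big_nat_recr n.+2) //= zE -mulgA yE qE !mulgA.
Qed.

(** * The action of [Delta] on the trivial tuple *)

Lemma actm_pass k x L : within k x ->
  actm x (Down e k.-1 :: L) = omap (cons (Down e k.-1)) (actm x L).
Proof.
rewrite /actm /within; elim: (word_of x) L => // g u IH L /andP[gk uk].
rewrite map_cons !acts_cons.
(* At level [k.+1] the state [Down k.-1] is the empty prefix; generators of level at most [k] cross
   it unchanged. *)
have stepE : step (Down e k.-1) (letter_of g) = Some (inr (letter_of g)).
  by case: g gk => [i|[j jr]] /= gk; decide_ifs.
rewrite (act_pass _ stepE); by case: (act _ L) => //= L'; exact: IH.
Qed.

Lemma actm_down n d L : n.+2 <= r -> d <= n ->
  actm (down n.+2 (n - d).+3) (Down e n :: L) = Some (Down e (n - d) :: L).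
Proof.
move=> nr; elim: d => [|d IH] dn; first by rewrite subn0 down_nil // actm1.
rewrite down_r; last lia.
have nd : n - d = (n - d.+1).+1 by lia.
rewrite nd in IH.
rewrite actmM IH /=; last lia.
by rewrite actm_s /=; [decide_ifs|lia].
Qed.

Lemma actm_up c L : c.+2 <= r ->
  actm (up c.+2) (Up e 0 :: L) = Some (Up e c :: L).
Proof.
elim: c => [|c IH] cr; first by rewrite up_nil // actm1.
rewrite up_r // actmM IH /=; last lia.
rewrite actm_s //=; case: eqP => [|_]; first lia.
by rewrite eqxx.
Qed.

Lemma actm_Lambda n L : n.+2 <= r ->
  actm (Lambda n.+2) (Down e n :: L) = Some (Up e n :: L).
Proof.
move=> nr; rewrite LambdaE 2!actmM.
have := @actm_down n n L nr (leqnn _); rewrite subnn => -> /=.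
(* [tau] is [t_1 t_0], and [0 = 1 - 1] is exactly the index allowed after [Mid 1]. *)
rewrite actmM actm_t /= actm_t /= subrr eqxx /=.
exact: actm_up.
Qed.

(** The tuple (1, ..., 1): [Down n'] is the empty prefix at level [n' + 2]. *)
Fixpoint start (n : nat) : seq (state e) :=
  if n is n'.+1 then Down e n' :: start n' else [::].

Lemma startP n : [/\ size (start n) =
  n, valid_seq (start n) & seq_val (start n) = 1].
Proof.
elim: n => //= n [-> -> ->]; split=> //; first by rewrite ltnSn.
by rewrite down_nil ?mul1g.
Qed.

(** The lower [Lambda] factors pass through the empty top entry and act on the rest; the last factor
    then fills the top entry completely. *)
Lemma actm_prod_Lambda n : n < r ->
  actm (\prod_(2 <= k < n.+2) Lambda k) (start n) <> None.
Proof.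
elim: n => [|n IH] nr; first by rewrite big_geq // actm1.
rewrite big_nat_recr //= actmM (@actm_pass n.+1).
  case: (actm _ _) IH => [L|] IH /=; last by case: (IH (ltnW nr)).
  by rewrite actm_Lambda.
rewrite big_nat_cond; elim/big_rec: _ => [|j x jn xk]; first exact: within1.
by rewrite withinM xk (withinW _ (within_Lambda _)) //; lia.
Qed.

(** * From tuples of states to products of left divisors *)

Lemma ldvd_down k j : 2 < j <= k.+1 -> ldvd (down k j) (down k 3).
Proof.
elim: j => [|j IH] jk; first lia.
have [j3|j3] := ltnP 2 j;
  last by have -> : j.+1 = 3; [lia|exists 1; rewrite mulg1].
have [|z ->] := IH; first lia.
by exists (s j * z); rewrite mulgA -down_r //; lia.
Qed.

Lemma ldvd_up c k : 2 <= c <= k -> ldvd (up c) (up k).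
Proof.
elim: k => [|k IH] ck; first lia.
have [ck'|ck'] := leqP c k;
  last by have -> : c = k.+1; [lia|exists 1; rewrite mulg1].
have [|z E] := IH; first lia.
by exists (z * s k.+1); rewrite mulgA -E up_r //; lia.
Qed.

Lemma ldvd_state_val k p : valid k p -> ldvd (state_val k p) (Lambda k).
Proof.
rewrite LambdaE; case: p => [b|i|c] /= pk.
- have [|z ->] := @ldvd_down k b.+3; first lia.
  by exists (z * tau * up k); rewrite !mulgA.
- by exists (t (i - 1)%R * up k); rewrite -(t_tau i) !mulgA.
- by have [|z ->] := @ldvd_up c.+2 k; [lia|exists z; rewrite !mulgA].
Qed.

Lemma seq_val_prod L : valid_seq L -> exists p : nat -> B,
  (forall k, 2 <= k <= (size L).+1 -> ldvd (p k) (Lambda k)) /\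
  seq_val L = \prod_(2 <= k < (size L).+2) p k.
Proof.
elim: L => [|p L IH] /=;
  first by exists (fun=> 1); rewrite big_geq; split=> // k; lia.
case/andP=> pV /IH[q [qL ->]].
exists (fun k => if k == (size L).+2 then state_val k p else q k); split.
  move=> k kL; case: eqP => [->|kL']; first exact: ldvd_state_val.
  by apply: qL; lia.
rewrite [RHS]big_nat_recr //= eqxx; congr (_ * _).
by apply: eq_big_nat => k kL; case: eqP => //; lia.
Qed.

End Braid.

Theorem theorem3p7 (e r : nat) (he : (2 <= e)%N) (hr : (2 <= r)%N)
    (x : braid e r) :
  simple x <->
  exists p : nat -> braid e r,
    (forall k : nat, (2 <= k <= r)%N -> ldvd (p k) (Lambda e r k)) /\
    x = \prod_(2 <= k < r.+1) p k.
Proof.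
have r0 : r.-1.+1 = r by lia.
have r1 : r.-1 < r by lia.
split=> [[z DE]|[p [pL ->]]].
  have := @actm_prod_Lambda e r r.-1 r1.
  rewrite r0 -[\prod_(_ <= _ < _) _]/(Delta e r) DE actmM.
  (* If [x] were undefined on the trivial tuple, so would be [x * z], which is [Delta]. *)
  case xE: (actm x _) => [L|//] _.
  have [sz V E] := startP e r r.-1.
  have [||//|sz' V' E'] := acts_val _ _ _ xE; rewrite ?sz //.
  have [p] := seq_val_prod r V'.
  rewrite sz' sz r0 E' E mul1g word_ofK => -[pL xp].
  by exists p.
have := @ldvd_prod_Lambda e r r.-1 p r1.
by rewrite r0 => /(_ pL)[z _ zE]; exists z.
Qed.
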